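(* Let $a\in(\sqrt3/3,\sqrt3)$, put $s=\sqrt{a^2+1}$, and let $m=m(a)>0$ be the solution of $$s^3(a^3-m)+8a^3(m-1)=0,\qquad\text{i.e.}\qquad m(a)=\frac{a^3(s^3-8)}{s^3-8a^3},$$ so that the four bodies with masses $m_1=m_3=m$, $m_2=m_4=1$ at $\mathbf r_1=(0,a)$, $\mathbf r_2=(-1,0)$, $\mathbf r_3=(0,-a)$, $\mathbf r_4=(1,0)$ form a rhombus central configuration. Then the restricted Hessian $H_{\mathcal C}$ is positive definite on the rotation-free subspace $\mathcal W$. Consequently, the Morse index of the rhombus central configuration is zero.
   Context: Four bodies have masses $m_1,\dots,m_4>0$, $M=\sum_i m_i$, pairwise distinct positions $\mathbf r_i\in\mathbb R^2$ with $\sum_i m_i\mathbf r_i=0$; $\mathbf q_{ij}=\mathbf r_i-\mathbf r_j$, $q_{ij}=|\mathbf q_{ij}|$, $\hat{\mathbf q}_{ij}=\mathbf q_{ij}/q_{ij}$, $\mu_{ij}=m_im_j/M$. The configuration is central if there is $\omega^2>0$ with $\omega^2m_i\mathbf r_i=\sum_{j\ne i}\frac{m_im_j}{q_{ij}^3}\mathbf q_{ij}$ for all $i$ (such $\omega^2$ is then uniquely determined). Put $\mathbf A_{ij}=\mathbf A_{ji}=\mu_{ij}\bigl(\omega^2-\frac{M}{q_{ij}^3}\bigr)\mathbf I_2+\frac{3M\mu_{ij}}{q_{ij}^3}\hat{\mathbf q}_{ij}\hat{\mathbf q}_{ij}^T$. The restricted Hessian $H_{\mathcal C}\in\mathbb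 R^{6\times6}$ is the $3\times3$ array of $2\times2$ blocks indexed by $a',b'\in\{2,3,4\}$: $(H_{\mathcal C})_{a'-1,a'-1}=\sum_{k\ne a'}\mathbf A_{a'k}$ (sum over $k\in\{1,2,3,4\}$, $k\ne a'$), $(H_{\mathcal C})_{a'-1,b'-1}=-\mathbf A_{a'b'}$ $(a'\ne b')$. It is the Hessian of $U_\pi+\frac{\omega^2}2I_\pi$, where $U_\pi=\sum_{i<j}\frac{M\mu_{ij}}{q_{ij}}$ and $I_\pi=\sum_{i<j}\mu_{ij}q_{ij}^2$, as a function of $(\mathbf q_{12},\mathbf q_{13},\mathbf q_{14})\in\mathbb R^6$ with $\mathbf q_{ij}=\mathbf q_{1j}-\mathbf q_{1i}$ for $2\le i<j\le4$. Let $\mathbf q=(\mathbf q_{12}^T,\mathbf q_{13}^T,\mathbf q_{14}^T)^T$, $\mathbf J=\begin{pmatrix}0&-1\\1&0\end{pmatrix}$, $\mathbf v=(\mathbf I_3\otimes\mathbf J)\mathbf q$ (the infinitesimal rotation; here $\mathbf v=(-a,1,-2a,0,-a,-1)^T$). The rotation-free subspace is $\mathcal W=\mathbf v^\perp\subset\mathbb R^6$. The Morse index of a central configuration is the number of negative eigenvalues (with multiplicity) of the second variation of $U_\pi$ at $\mathbf q$ on the level set of $I_\pi$ through $\mathbf q$ in $\mathbb R^6$, i.e. of the quadratic form of $H_{\mathcal C}$ restricted to the tangent space at $\mathbf q$ of that level set. *)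

(* Defs.v *)
From HB Require Import structures.
From mathcomp Require Import all_boot all_order all_algebra.
From mathcomp Require Import all_classical all_reals all_analysis.
From mathcomp Require Import polyrcf mxtens.

Set Implicit Arguments.
Unset Strict Implicit.
Unset Printing Implicit Defensive.

Import Order.TTheory GRing.Theory Num.Theory.
Import numFieldNormedType.Exports.

Local Open Scope ring_scope.

Section LinearAlgebra.
Variable R : realType.

(* The norm `|x| of the library on matrices is the sup norm. *)
Definition enorm n (x : 'cV[R]_n) : R := Num.sqrt ((x^T *m x) 0 0).

(* Subspaces of R^n are encoded as row spaces of matrices (scope %MS); for a
   column vector v, the row space of kermx v is the orthogonal of v. *)
Definition posdef_on n m (H : 'M[R]_n) (W : 'M[R]_(m, n)) : Prop :=
  forall x : 'rV[R]_n, (x <= W)%MS -> x != 0 -> 0 < (x *m H *m x^T) 0 0.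

(* The rows of B form a basis of W, and B^T (B B^T)^-1 B is the orthogonal
   projection P onto W: this is the matrix, in the basis B, of the self-adjoint
   endomorphism x |-> x H P of W representing the quadratic form x H x^T
   restricted to W. *)
Definition restrict_form n m (H : 'M[R]_n) (W : 'M[R]_(m, n)) : 'M[R]_(\rank W) :=
  let B := row_base W in B *m H *m B^T *m invmx (B *m B^T).

Definition nb_neg_eigenvalues n (A : 'M[R]_n) : nat :=
  \sum_(x <- rootsR (char_poly A) | x < 0) mup x (char_poly A).

Definition gradient n (f : 'cV[R]_n.+1 -> R) (x : 'cV[R]_n.+1) : 'cV[R]_n.+1 :=
  \col_i 'D_(delta_mx i 0) f x.

(* Tangent space at x of the level set of f through x. *)
Definition level_tangent n (f : 'cV[R]_n.+1 -> R) (x : 'cV[R]_n.+1) : 'M[R]_n.+1 :=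
  kermx (gradient f x).

Definition J2 : 'M[R]_2 :=
  \matrix_(i < 2, j < 2) (if i == j then 0 else if i == 0 then -1 else 1).

Definition vec2 (x y : R) : 'cV[R]_2 := \col_(i < 2) (if i == 0 then x else y).

End LinearAlgebra.

(* Bodies 1, 2, 3, 4 are indexed by 0, 1, 2, 3 : 'I_4. *)
Section FourBodies.
Variable R : realType.
Variables (m : 'I_4 -> R) (r : 'I_4 -> 'cV[R]_2).

Definition four_bodies : Prop :=
  [/\ forall i, 0 < m i, injective r & \sum_i m i *: r i = 0].

Definition total_mass : R := \sum_i m i.
Definition qvec (i j : 'I_4) : 'cV[R]_2 := r i - r j.
Definition qdist (i j : 'I_4) : R := enorm (qvec i j).
Definition qhat (i j : 'I_4) : 'cV[R]_2 := (qdist i j)^-1 *: qvec i j.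
Definition mu (i j : 'I_4) : R := m i * m j / total_mass.

Definition central_with (w2 : R) : Prop :=
  0 < w2 /\
  forall i, (w2 * m i) *: r i =
    \sum_(j | j != i) (m i * m j / qdist i j ^+ 3) *: qvec i j.

Definition central_configuration : Prop :=
  four_bodies /\ exists w2, central_with w2.

Definition Ablock (w2 : R) (i j : 'I_4) : 'M[R]_2 :=
  (mu i j * (w2 - total_mass / qdist i j ^+ 3))%:M
  + (3 * total_mass * mu i j / qdist i j ^+ 3) *: (qhat i j *m (qhat i j)^T).

Definition Hblock (w2 : R) (a b : 'I_4) : 'M[R]_2 :=
  if a == b then \sum_(k | k != a) Ablock w2 a k else - Ablock w2 a b.

(* Coordinates of R^6 are indexed by 'I_(3 * 2): mxtens_unindex i is the pair
   (block, coordinate in the block), as in the Kronecker product *t; the block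
   b : 'I_3 corresponds to the body lift ord0 b : 'I_4. *)
Definition restricted_Hessian (w2 : R) : 'M[R]_(3 * 2) :=
  \matrix_(i, j)
    Hblock w2 (lift ord0 (mxtens_unindex i).1) (lift ord0 (mxtens_unindex j).1)
      (mxtens_unindex i).2 (mxtens_unindex j).2.

Definition qstack : 'cV[R]_(3 * 2) :=
  \col_i qvec ord0 (lift ord0 (mxtens_unindex i).1) (mxtens_unindex i).2 0.

Definition rotation : 'cV[R]_(3 * 2) := (1%:M *t J2 R) *m qstack.

Definition rotation_free : 'M[R]_(3 * 2) := kermx rotation.

(* For x = (q_12, q_13, q_14), q1 x j is q_1j, with q_11 = 0. *)
Definition q1 (x : 'cV[R]_(3 * 2)) (j : 'I_4) : 'cV[R]_2 :=
  if unlift ord0 j is Some b then \col_c x (mxtens_index (b, c)) 0 else 0.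

Definition I_pi (x : 'cV[R]_(3 * 2)) : R :=
  \sum_(i < 4) \sum_(j < 4 | (i < j)%N) mu i j * enorm (q1 x j - q1 x i) ^+ 2.

(* The second variation of U_pi on the level set of I_pi is the restriction to
   the tangent space of the Hessian of the Lagrangian U_pi + (w2 / 2) I_pi,
   which is restricted_Hessian w2. *)
Definition morse_index (w2 : R) : nat :=
  nb_neg_eigenvalues
    (restrict_form (restricted_Hessian w2) (level_tangent I_pi qstack)).

End FourBodies.

Section Rhombus.
Variables (R : realType) (a : R).

Definition rhombus_s : R := Num.sqrt (a ^+ 2 + 1).

Definition rhombus_mass : R :=
  a ^+ 3 * (rhombus_s ^+ 3 - 8) / (rhombus_s ^+ 3 - 8 * a ^+ 3).

Definition rhombus_masses (m : R) (i : 'I_4) : R := [:: m; 1; m; 1]`_i.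

Definition rhombus_positions (i : 'I_4) : 'cV[R]_2 :=
  nth 0 [:: vec2 0 a; vec2 (-1) 0; vec2 0 (- a); vec2 1 0] i.

End Rhombus.

(* Main.v *)
(** The quadratic form of the restricted Hessian is the sum over the pairs i < j
    of (z_i - z_j)^T A_ij (z_i - z_j).  The two reflection symmetries of the
    rhombus split R^6 into blocks of dimension 2, 2, 1, 1 in the variables u
    (diagonal 13), v (diagonal 24) and w (difference of the midpoints of the
    diagonals), and the relations
      w2 = m / (4 a^3) + 2 / s^3 = 1 / 4 + 2 m / s^3
    turn the form into a combination of the squares of
      u_y, v_x, a u_y - v_x, u_x - a v_y, w_x, w_y
    with positive coefficients.  It thus vanishes only on the line
    u_y = v_x = w = 0, u_x = a v_y, which is spanned by the rotation.  As the
    form is nonnegative on R^6, its restriction to any subspace has no negative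
    eigenvalue. *)

Require Import Defs.
From mathcomp Require Import all_boot all_order all_algebra.
From mathcomp Require Import all_classical all_reals all_analysis.
From mathcomp Require Import mxtens polyrcf ring lra.

Import Order.TTheory GRing.Theory Num.Theory.
Local Open Scope ring_scope.

(** * Case analysis and sums over small index sets *)

Local Notation o0 := (@Ordinal 4 0 isT).
Local Notation o1 := (@Ordinal 4 1 isT).
Local Notation o2 := (@Ordinal 4 2 isT).
Local Notation o3 := (@Ordinal 4 3 isT).

(** The four cases carry literal ordinals, so that the lists of masses and positions compute by
    [/=]. *)
Lemma forall_ord4 (P : 'I_4 -> Prop) :
  P o0 -> P o1 -> P o2 -> P o3 -> forall i, P i.
Proof.
by move=> P0 P1 P2 P3 [[|[|[|[|i]]]] hi] //; rewrite (bool_irrelevance hi isT).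
Qed.

Lemma forall_ord2 (P : 'I_2 -> Prop) : P ord0 -> P ord_max -> forall c, P c.
Proof.
move=> P0 P1 [[|[|c]] hc] //.
- by congr (P _): P0; apply: val_inj.
- by congr (P _): P1; apply: val_inj.
Qed.

Lemma sum_ord4 (V : nmodType) (F : 'I_4 -> V) :
  \sum_i F i = F o0 + F o1 + F o2 + F o3.
Proof.
rewrite !big_ord_recl big_ord0 addr0 !addrA.
by do 3 ?congr (_ + _); congr F; apply: val_inj.
Qed.

Lemma sum_ord2 (V : nmodType) (F : 'I_2 -> V) :
  \sum_i F i = F ord0 + F ord_max.
Proof. by rewrite big_ord_recr big_ord1; congr (F _ + _); apply: val_inj. Qed.

(** * Mutual distances and equations of the rhombus central configuration *)

Section Rhombus.
Variables (R : realType) (a m : R).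
Hypotheses (a0 : 0 < a) (m0 : 0 < m).
Let s := rhombus_s a.
Let mass := rhombus_masses m.
Let pos := rhombus_positions a.

Lemma rhombus_s_gt0 : 0 < s.
Proof. by rewrite sqrtr_gt0; nra. Qed.

Lemma rhombus_s_sqr : s ^+ 2 = a ^+ 2 + 1.
Proof. by rewrite sqr_sqrtr; nra. Qed.

(** With indices from 0, even bodies lie on the vertical diagonal and odd ones on the horizontal
    diagonal, so the parity of [i + j] separates sides from diagonals. *)
Lemma rhombus_qdist i j : i != j ->
  qdist pos i j = if odd (i + j) then s else if odd i then 2 else 2 * a.
Proof.
have E x y z : z >= 0 -> x ^+ 2 + y ^+ 2 = z ^+ 2 ->
    Num.sqrt (x * x + y * y) = z.
  by move=> z0 h; rewrite -!expr2 h sqrtr_sqr ger0_norm.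
have s0 := ltW rhombus_s_gt0; have s2 := rhombus_s_sqr; have a0' := ltW a0.
rewrite /qdist /enorm /qvec /pos /rhombus_positions mxE sum_ord2 !mxE /=.
elim/forall_ord4: i; elim/forall_ord4: j => //= _; rewrite !mxE /=;
  apply: E; rewrite ?s2 ?mulr_ge0 //; ring.
Qed.

(** The vertical component at body 1 and the horizontal one at body 2 give the two equations; bodies
    3 and 4 repeat them by reflection, and the other components vanish identically. *)
Lemma rhombus_central_withE w2 : central_with mass pos w2 <->
  [/\ 0 < w2, w2 = m / (4 * a ^+ 3) + 2 / s ^+ 3 & w2 = 4^-1 + 2 * m / s ^+ 3].
Proof.
have s0 := rhombus_s_gt0.
split.
- case=> w0 h.
  have := congr1 (fun v : 'cV_2 => v ord_max 0) (h o0).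
  have := congr1 (fun v : 'cV_2 => v ord0 0) (h o1).
  rewrite !(big_mkcond (fun j => j != _)) /= !sum_ord4 /= !rhombus_qdist //=.
  rewrite /qvec /pos /rhombus_positions /mass /rhombus_masses !mxE /= ?mxE /=.
  move=> h1 h0; split => //.
  + apply: (mulIf (_ : m * a != 0)); first by rewrite mulf_neq0 ?gt_eqF.
    by rewrite (mulrA w2) h0; field; rewrite !gt_eqF.
  + apply: (mulIf (_ : -1 != 0)); first by rewrite oppr_eq0 oner_eq0.
    by rewrite -{1}[w2]mulr1 h1; field; rewrite !gt_eqF.
- case=> w0 e1 e2; split => // i.
  apply/matrixP => c d; rewrite ord1 {d}.
  rewrite !(big_mkcond (fun j => j != _)) /= !sum_ord4 /=.
  elim/forall_ord4: i; rewrite /= !rhombus_qdist //= /qvec /pos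
    /rhombus_positions /mass /rhombus_masses;
    elim/forall_ord2: c; rewrite !mxE /= ?mxE /=;
    (by rewrite e1; field; rewrite !gt_eqF)
    || (by rewrite e2; field; rewrite !gt_eqF).
Qed.

Lemma rhombus_total_mass : total_mass mass = 2 * m + 2.
Proof. by rewrite /total_mass sum_ord4 /mass /rhombus_masses /=; ring. Qed.
End Rhombus.

(** * The Hessian form as a sum over pairs of bodies *)

Section QuadraticForms.
Variable R : realType.

Lemma enormN n (x : 'cV[R]_n) : enorm (- x) = enorm x.
Proof. by rewrite /enorm [(- _)^T]linearN mulNmx mulmxN opprK. Qed.

Variables (m : 'I_4 -> R) (r : 'I_4 -> 'cV[R]_2) (w2 : R).

Lemma AblockC i j : Ablock m r w2 i j = Ablock m r w2 j i.
Proof.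
have vC : qvec r j i = - qvec r i j by rewrite opprB.
have dC : qdist r j i = qdist r i j by rewrite /qdist vC enormN.
have hC : qhat r j i = - qhat r i j by rewrite /qhat dC vC scalerN.
by rewrite /Ablock hC dC /mu (mulrC (m j)) [(- _)^T]linearN mulNmx mulmxN opprK.
Qed.

Lemma Ablock_form i j (d : 'cV[R]_2) :
  (d^T *m Ablock m r w2 i j *m d) 0 0 =
  mu m i j * ((w2 - total_mass m / qdist r i j ^+ 3)
                * (d ord0 0 ^+ 2 + d ord_max 0 ^+ 2)
    + 3 * total_mass m / qdist r i j ^+ 3
      * (qhat r i j ord0 0 * d ord0 0
         + qhat r i j ord_max 0 * d ord_max 0) ^+ 2).
Proof. by rewrite !(mxE, sum_ord2, big_ord1) /=; ring. Qed.

Lemma sum_tens p q (F : 'I_(p * q) -> R) :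
  \sum_i F i = \sum_b \sum_c F (mxtens_index (b, c)).
Proof.
rewrite pair_big /= (reindex (@mxtens_index p q)) /=.
  by apply: eq_bigr => -[].
by exists (@mxtens_unindex p q) => i _;
  rewrite (mxtens_indexK, mxtens_unindexK).
Qed.

Lemma rotationE b c : rotation r (mxtens_index (b, c)) 0 =
  \sum_d J2 R c d * qvec r ord0 (lift ord0 b) d 0.
Proof.
rewrite /rotation mxE sum_tens (bigD1 b) //= [X in _ + X]big1 ?addr0
  => [|b' nb].
  by apply: eq_bigr => d _; rewrite tensmxE !mxE eqxx mul1r !mxtens_indexK.
by rewrite big1 // => d _; rewrite tensmxE mxE eq_sym (negbTE nb) !mul0r.
Qed.

(** The Hessian is the matrix-weighted Laplacian of the complete graph on the bodies, with the row
    and column of body 1 removed; setting [z o0 = 0] restores that body. *)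
Lemma restricted_Hessian_form (x : 'rV[R]_(3 * 2)) :
  let z := q1 x^T in
  (x *m restricted_Hessian m r w2 *m x^T) 0 0 =
  \sum_(i < 4) \sum_(j < 4 | (i < j)%N)
     ((z j - z i)^T *m Ablock m r w2 i j *m (z j - z i)) 0 0.
Proof.
move=> z.
have z0 : z o0 = 0 by rewrite /z /q1; case: unliftP => // k /(congr1 val).
have zE b c : x 0 (mxtens_index (b, c)) = z (lift ord0 b) c 0.
  by rewrite /z /q1 liftK !mxE.
have sum3 (F : 'I_4 -> R) : \sum_b F (lift ord0 b) = F o1 + F o2 + F o3.
  rewrite !big_ord_recl big_ord0 addr0 !addrA.
  by do 2 ?congr (_ + _); congr F; apply: val_inj.
pose f u A v : R := ((u : 'cV[R]_2)^T *m A *m (v : 'cV[R]_2)) 0 0.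
have fN u A : f u (- A) =1 (fun v => - f u A v).
  by move=> v; rewrite /f mulmxN mulNmx mxE.
have fD u A B v : f u (A + B) v = f u A v + f u B v.
  by rewrite /f mulmxDr mulmxDl mxE.
have fB u v A : f (u - v) A (u - v) = f u A u - f u A v - f v A u + f v A v.
  rewrite /f [(_ - _)^T]linearB /= !mulmxBr !mulmxBl.
  by rewrite !mxE; ring.
have f0l A v : f 0 A v = 0 by rewrite /f trmx0 !mul0mx mxE.
have f0r A u : f u A 0 = 0 by rewrite /f !mulmx0 mxE.
transitivity (\sum_a \sum_b
   f (z (lift ord0 a)) (Hblock m r w2 (lift ord0 a) (lift ord0 b))
     (z (lift ord0 b))).
  have term b d : (x *m restricted_Hessian m r w2) 0 (mxtens_index (b, d))
      * x^T (mxtens_index (b, d)) 0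
      = \sum_a \sum_c z (lift ord0 a) c 0
          * Hblock m r w2 (lift ord0 a) (lift ord0 b) c d * z (lift ord0 b) d 0.
    rewrite !mxE sum_tens mulr_suml; apply: eq_bigr => a _.
    rewrite mulr_suml; apply: eq_bigr => c _.
    by rewrite mxE !mxtens_indexK !zE.
  rewrite mxE sum_tens [RHS]exchange_big; apply: eq_bigr => b _ /=.
  rewrite (eq_bigr _ (fun d _ => term b d)) exchange_big; apply: eq_bigr => a _.
  rewrite /f mxE; apply: eq_bigr => d _; rewrite mxE mulr_suml.
  by apply: eq_bigr => c _; rewrite mxE.
under [RHS]eq_bigr do under eq_bigr do rewrite -/(f _ _ _).
(* What remains is an identity between bilinear expressions in symmetric blocks; [f], [z] and the
   blocks become opaque so that [ring] sees scalar atoms. *)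
rewrite /Hblock; have := AblockC; move: (Ablock m r w2) => A AC.
clearbody f z.
pose g a b :=
  f (z a) (if a == b then \sum_(k | k != a) A a k else - A a b) (z b).
rewrite (eq_bigr _ (fun a _ => sum3 (g (lift ord0 a)))).
rewrite (sum3 (fun a => g a o1 + g a o2 + g a o3)) /g.
rewrite sum_ord4 !(big_mkcond (fun j : 'I_4 => (_ < j)%N)) !sum_ord4 /=.
rewrite !(big_mkcond (fun j => j != _)) /= !sum_ord4 /=.
rewrite (AC o1 o0) (AC o2 o0) (AC o3 o0) (AC o2 o1) (AC o3 o1) (AC o3 o2) z0.
rewrite !(add0r, addr0).
rewrite !(fN, fD, fB).
rewrite !(f0l, f0r).
ring.
Qed.
End QuadraticForms.

(** * Negative eigenvalues of a restricted form *)

Section NegativeEigenvalues.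
Variable R : realType.

Lemma dotmx_gt0 n (x : 'rV[R]_n) : x != 0 -> 0 < (x *m x^T) 0 0.
Proof.
have sq i : true -> 0 <= x 0 i * x^T i 0 by rewrite mxE -expr2 sqr_ge0.
move=> x0; rewrite mxE lt_neqAle sumr_ge0 // andbT eq_sym psumr_eq0 //.
apply: contra x0 => /allP h; apply/eqP/rowP => i; rewrite mxE.
by have := h i (mem_index_enum i); rewrite mxE mulf_eq0 orbb => /eqP.
Qed.

Lemma nb_neg_eigenvalues_restrict n k (H : 'M[R]_n) (W : 'M[R]_(k, n)) :
  (forall x : 'rV[R]_n, 0 <= (x *m H *m x^T) 0 0) ->
  nb_neg_eigenvalues (restrict_form H W) = 0%N.
Proof.
(* With S = B H B^T and G = B B^T, v S G^-1 = l v gives v S v^T = l v G v^T. *)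
move=> H0; rewrite /nb_neg_eigenvalues /restrict_form.
set B := row_base W; set G := B *m B^T.
(* [G] is the Gram matrix of a basis: [v G v^T] is the squared norm of [v B], and the rows of [B]
   are free. *)
have posG (v : 'rV_(\rank W)) : v != 0 -> 0 < (v *m G *m v^T) 0 0.
  move=> v0; rewrite /G mulmxA -mulmxA -trmx_mul; apply: dotmx_gt0.
  by apply: contra v0 => /eqP vB0; apply/eqP/(row_free_inj (row_base_free W));
    rewrite mul0mx.
have unitG : G \in unitmx.
  rewrite -row_free_unit; apply: inj_row_free => v vG0.
  by apply/eqP/negP => /negP/posG; rewrite vG0 mul0mx mxE ltxx.
rewrite big_seq_cond big_pred0 // => l; apply/negP => /andP[lroot l0].
have : l \in `]-oo, +oo[ by rewrite in_itv.
have := roots_on_rootsR (monic_neq0 (char_poly_monic (B *m H *m B^T *m invmx G))).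
move=> /(_ l); rewrite lroot in_itv /= -eigenvalue_root_char.
move=> /eigenvalueP[v vS v0] _.
have vS' : v *m (B *m H *m B^T) = l *: (v *m G).
  by rewrite -[X in _ *m X](mulmxKV unitG) mulmxA vS -scalemxAl.
have := H0 (v *m B).
rewrite (_ : _ *m (v *m B)^T = v *m (B *m H *m B^T) *m v^T); last first.
  by rewrite trmx_mul !mulmxA.
by rewrite vS' -scalemxAl mxE leNgt nmulr_rlt0 ?posG.
Qed.
End NegativeEigenvalues.

(** * The rhombus form as a positive combination of squares *)

Section RhombusForm.
Variables (R : realType) (a m w2 : R).
Hypotheses (a0 : 0 < a) (m0 : 0 < m).
Let s := rhombus_s a.
Let mass := rhombus_masses m.
Let pos := rhombus_positions a.
Hypothesis cc : central_with mass pos w2.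
Let M := 2 * m + 2.
Let g := w2 - M / s ^+ 3.
Let c := 3 * M / s ^+ 5.

(* The body j has displacement - y (j - 2) relative to body 1, so u and v are
   the displacements along the two diagonals and w that between their
   midpoints. The A_13 and A_24 terms are absorbed by side13 and side24: these
   two consequences of the central configuration equations make the block that
   contains the rotation the single square (u_x - a v_y)^2. *)
Lemma rhombus_form (x : 'rV[R]_(3 * 2)) :
  let y (b : nat) (i : 'I_2) := x 0 (mxtens_index (inord b, i)) in
  let u := y 1%N in
  let v i := y 2%N i - y 0%N i in
  let w i := (y 0%N i + y 2%N i - y 1%N i) / 2 in
  (x *m restricted_Hessian mass pos w2 *m x^T) 0 0 =
  (3 * M * m ^+ 2 / (8 * a ^+ 3) * u ord_max ^+ 2
   + 3 * M / 8 * v ord0 ^+ 2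
   + m * (c * (a * u ord_max - v ord0) ^+ 2 + c * (u ord0 - a * v ord_max) ^+ 2
          + 4 * ((g + c) * w ord0 ^+ 2
                 + (g + c * a ^+ 2) * w ord_max ^+ 2))) / M.
Proof.
move=> y u v w.
have s0 : 0 < s := rhombus_s_gt0 R a.
have M0 : 0 < M by rewrite addr_gt0 ?mulr_gt0.
have [_ e1 e2] := (rhombus_central_withE R a m a0 m0 w2).1 cc.
have zE b : q1 x^T (lift ord0 b) = \col_c y b c.
  by apply/colP => i; rewrite /q1 liftK !mxE /y inord_val.
have z0 : q1 x^T o0 = 0 by rewrite /q1; case: unliftP => // k /(congr1 val).
have z1 : q1 x^T o1 = \col_c y 0 c.
  by rewrite -(zE ord0); congr q1; apply: val_inj.
have z2 : q1 x^T o2 = \col_c y 1%N c.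
  by rewrite -(zE (lift ord0 ord0)); congr q1; apply: val_inj.
have z3 : q1 x^T o3 = \col_c y 2%N c.
  by rewrite -(zE ord_max); congr q1; apply: val_inj.
rewrite restricted_Hessian_form sum_ord4.
rewrite !(big_mkcond (fun j : 'I_4 => (_ < j)%N)) !sum_ord4 /= z0 z1 z2 z3.
rewrite !Ablock_form /qhat !rhombus_qdist //= rhombus_total_mass -/M -/s.
rewrite /qvec /pos /rhombus_positions /mu rhombus_total_mass -/M /mass
  /rhombus_masses.
rewrite !mxE /= ?mxE /= {}/w {}/v {}/u.
have side13 : w2 - M / (2 * a) ^+ 3 = - g / m.
  by rewrite /g e1 /M -/s; field; rewrite !gt_eqF.
have side24 : w2 - M / 2 ^+ 3 = - m * g.
  by rewrite /g e2 /M -/s; field; rewrite !gt_eqF.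
rewrite side13 side24 -/g /c.
by field; rewrite !gt_eqF.
Qed.

(** Each half inserts the expression of [w2] that cancels one of the two mass terms of [M / s ^+ 3];
    it then remains to bound a polynomial in [a] and [s], free of [m]. *)
Lemma rhombus_form_coef_gt0 : 0 < g + c /\ 0 < g + c * a ^+ 2.
Proof.
have s0 : 0 < s := rhombus_s_gt0 R a.
have s2 : s ^+ 2 = a ^+ 2 + 1 := rhombus_s_sqr R a.
have [_ e1 e2] := (rhombus_central_withE R a m a0 m0 w2).1 cc.
have p0 : 0 < s ^+ 5 by apply: exprn_gt0.
split.
- have -> : g + c = (s ^+ 5 - 8 * s ^+ 2 + 24 + 24 * m) / (4 * s ^+ 5).
    by rewrite /c /g e2 /M -/s; field; rewrite !gt_eqF.
  apply: divr_gt0; last by rewrite mulr_gt0.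
  suff : 0 < s ^+ 5 - 8 * s ^+ 2 + 24 by move: m0; lra.
  have [h|h] := lerP (s ^+ 2) 2.
    by move: p0 h; lra.
  have -> : s ^+ 5 = s ^+ 2 * s ^+ 2 * s by ring.
  (* [7 / 5] is a rational number just below the square root of 2. With t = s^2, the resulting bound
     (7/5) t^2 - 8 t + 24 has negative discriminant. *)
  have h1 : 7 / 5 < s by nra.
  have : s ^+ 2 * s ^+ 2 * s > s ^+ 2 * s ^+ 2 * (7 / 5).
    by rewrite ltr_pM2l // mulr_gt0 // exprn_gt0.
  nra.
- have -> : g + c * a ^+ 2 = (m * (s ^+ 5 - 8 * a ^+ 3 * s ^+ 2 + 24 * a ^+ 5)
      + 24 * a ^+ 5) / (4 * a ^+ 3 * s ^+ 5).
    by rewrite /c /g e1 /M -/s; field; rewrite !gt_eqF.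
  apply: divr_gt0; last by rewrite !mulr_gt0 ?exprn_gt0.
  apply: addr_gt0; last by rewrite mulr_gt0 ?exprn_gt0.
  apply: mulr_gt0 => //.
  have a2 : 0 < a ^+ 2 by apply: exprn_gt0.
  have s1 : 1 < s by nra.
  have s5 : 1 < s ^+ 5 by rewrite exprn_egt1.
  rewrite s2 (_ : _ + _ = (s ^+ 5 - 1) + (1 + 8 * a ^+ 3 * (2 * a ^+ 2 - 1)));
    last by ring.
  have a3 : 0 < a ^+ 3 by apply: exprn_gt0.
  apply: addr_gt0; first by rewrite subr_gt0.
  have [h|h] := lerP 1 a.
    by rewrite ltr_wpDr // mulr_ge0 ?mulr_ge0 ?ltW //; nra.
  (* For a < 1 the sign of 2 a^2 - 1 is open, but 16 a^4 - 8 a^2 + 1 is a perfect square. *)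
  rewrite (_ : 1 + _ = (1 - a) + a * (4 * a ^+ 2 - 1) ^+ 2); last by ring.
  by apply: ltr_wpDr; rewrite ?subr_gt0 // mulr_ge0 ?sqr_ge0 // ltW.
Qed.
End RhombusForm.

(** * Positive definiteness transverse to the rotation *)

Section RhombusDefinite.
Variables (R : realType) (a m w2 : R).
Hypotheses (a0 : 0 < a) (m0 : 0 < m).
Let mass := rhombus_masses m.
Let pos := rhombus_positions a.
Hypothesis cc : central_with mass pos w2.

Lemma rhombus_form_ge0 (x : 'rV[R]_(3 * 2)) :
  0 <= (x *m restricted_Hessian mass pos w2 *m x^T) 0 0.
Proof.
have s0 := rhombus_s_gt0 R a.
have [k1 k2] := rhombus_form_coef_gt0 R a m w2 a0 m0 cc.
rewrite (rhombus_form R a m w2) // /=.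
have M0 : 0 <= 2 * m + 2 by apply: addr_ge0; rewrite ?mulr_ge0 // ltW.
by do ?[exact: sqr_ge0 | exact: ltW k1 | exact: ltW k2 | exact: ltW
       | exact: exprn_ge0 (ltW _) | rewrite invr_ge0
       | apply: addr_ge0 | apply: mulr_ge0].
Qed.

Lemma rhombus_posdef :
  posdef_on (restricted_Hessian mass pos w2) (rotation_free pos).
Proof.
have s0 := rhombus_s_gt0 R a.
have [k1 k2] := rhombus_form_coef_gt0 R a m w2 a0 m0 cc.
have M0 : 0 < 2 * m + 2 by apply: addr_gt0; rewrite ?mulr_gt0.
(* By contraposition: if the form is not positive at [x], it is zero there, and every square in it
   vanishes. *)
move=> x /sub_kermxP xrot; apply: contraNT; rewrite -leNgt => le0.
have {le0} := le_anti (introT andP (conj le0 (rhombus_form_ge0 x))).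
rewrite (rhombus_form R a m w2) // => /eqP.
have k c (y : R) : 0 < c -> 0 <= c * y ^+ 2.
  by move=> cp; rewrite mulr_ge0 ?sqr_ge0 // ltW.
have kz c (y : R) : 0 < c -> c * y ^+ 2 = 0 -> y = 0.
  by move=> cp /eqP; rewrite mulf_eq0 gt_eqF //= sqrf_eq0 => /eqP.
have c1 : 0 < 3 * (2 * m + 2) * m ^+ 2 / (8 * a ^+ 3).
  by rewrite ?(divr_gt0, mulr_gt0, exprn_gt0).
have c2 : 0 < 3 * (2 * m + 2) / 8 by rewrite ?(divr_gt0, mulr_gt0).
have c3 : 0 < 3 * (2 * m + 2) / rhombus_s a ^+ 5.
  by rewrite ?(divr_gt0, mulr_gt0, exprn_gt0).
rewrite mulf_eq0 invr_eq0 (gt_eqF M0) orbF.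
have sum0 (p q : R) : 0 <= p -> 0 <= q -> p + q = 0 -> p = 0 /\ q = 0.
  by move=> p0 q0 pq; split; lra.
have mul0 (p q : R) : 0 < p -> p * q = 0 -> q = 0.
  by move=> p0 /eqP; rewrite mulf_eq0 gt_eqF // => /eqP.
(* Nonnegativity of the partial sums, used to split off the vanishing terms one by one. *)
have n34 y y' := addr_ge0 (k _ y c3) (k _ y' c3).
have n56 y y' := addr_ge0 (k _ y k1) (k _ y' k2).
move=> /eqP/(sum0 _ _ (addr_ge0 (k _ _ c1) (k _ _ c2))).
have n46 y3 y4 y5 y6 := addr_ge0 (n34 y3 y4) (mulr_ge0 (ler0n _ 4) (n56 y5 y6)).
move=> /(_ (mulr_ge0 (ltW m0) (n46 _ _ _ _)))[].
move=> /(sum0 _ _ (k _ _ c1) (k _ _ c2))[/kz-/(_ c1) uy /kz-/(_ c2) vx].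
move=> /(mul0 _ _ m0)/(sum0 _ _ (n34 _ _) (mulr_ge0 (ler0n _ 4) (n56 _ _)))[].
(* The square of a u_y - v_x is dropped: its vanishing already follows from [uy] and [vx]. *)
move=> /(sum0 _ _ (k _ _ c3) (k _ _ c3))[_ /kz-/(_ c3) ux].
move=> /(mul0 _ _ (ltr0Sn _ 3))/(sum0 _ _ (k _ _ k1) (k _ _ k2))[].
move=> /kz-/(_ k1) wx /kz-/(_ k2) wy.
have := congr1 (fun A : 'M[R]_1 => A 0 0) xrot.
rewrite mxE sum_tens !big_ord_recl !big_ord0 !rotationE !sum_ord2.
rewrite /qvec /pos /rhombus_positions !mxE /= ?mxE /=.
rewrite (_ : lift ord0 ord0 = inord 1 :> 'I_3); last exact/val_inj/esym/inordK.
rewrite (_ : lift ord0 (lift ord0 ord0) = inord 2 :> 'I_3);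
  last exact/val_inj/esym/inordK.
rewrite (_ : ord0 = inord 0 :> 'I_3); last exact/val_inj/esym/inordK.
rewrite (_ : lift ord0 ord0 = ord_max :> 'I_2); last exact/val_inj.
move=> rot.
(* Once u_y = v_x = w = 0 and u_x = a v_y are inserted, orthogonality to the rotation reads (3 a^2 +
   1) v_y = 0. *)
have y0 : x 0 (mxtens_index (inord 2, ord_max))
    - x 0 (mxtens_index (inord 0, ord_max)) = 0.
  by apply: (mul0 (3 * a ^+ 2 + 1)); nra.
rewrite y0 mulr0 subr0 in ux.
apply/eqP/rowP => i; case: (@mxtens_indexP 3 2 i) => b c.
rewrite mxE -[b]inord_val.
case: b => [[|[|[|b]]] hb] //; elim/forall_ord2: c => /=; lra.
Qed.
End RhombusDefinite.

(** * Sign of the mass and conclusion *)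

(** The ends of the interval are the values of [a] where s = 2 and s = 2 a. Inside it, both
    differences in the mass quotient are negative, so the mass is positive. *)
Lemma rhombus_mass_bounds (R : realType) (a : R) :
  Num.sqrt 3 / 3 < a -> a < Num.sqrt 3 ->
  [/\ 0 < a, rhombus_s a ^+ 3 < 8 & rhombus_s a ^+ 3 < 8 * a ^+ 3].
Proof.
move=> agt alt.
have r0 : 0 < Num.sqrt 3 :> R by rewrite sqrtr_gt0.
have r2 : Num.sqrt 3 ^+ 2 = 3 :> R by rewrite sqr_sqrtr.
have a0 : 0 < a by apply: lt_trans agt; rewrite divr_gt0.
have s0 := rhombus_s_gt0 R a; have s2 := rhombus_s_sqr R a.
split => //.
  rewrite (_ : 8 = 2 ^+ 3); last by ring.
  rewrite ltrXn2r // ?nnegrE ?ltW //; nra.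
rewrite (_ : 8 * a ^+ 3 = (2 * a) ^+ 3); last by ring.
rewrite ltrXn2r // ?nnegrE ?mulr_ge0 ?ltW //; nra.
Qed.

Theorem proposition7p1 (R : realType) (a : R)
    (ha_gt : Num.sqrt 3 / 3 < a) (ha_lt : a < Num.sqrt 3) :
  let s := rhombus_s a in
  let m := rhombus_mass a in
  let mass := rhombus_masses m in
  let pos := rhombus_positions a in
  [/\ 0 < m,
      (forall x : R,
         s ^+ 3 * (a ^+ 3 - x) + 8 * a ^+ 3 * (x - 1) = 0 <-> x = m),
      central_configuration mass pos &
      forall w2 : R, central_with mass pos w2 ->
        posdef_on (restricted_Hessian mass pos w2) (rotation_free pos) /\
        morse_index mass pos w2 = 0%N].
Proof.
move=> s m mass pos.
have [a0 s8 s8a] := rhombus_mass_bounds R a ha_gt ha_lt.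
have s0 : 0 < s := rhombus_s_gt0 R a.
have den : s ^+ 3 - 8 * a ^+ 3 != 0 by rewrite subr_eq0 lt_eqF.
have m0 : 0 < m.
  by rewrite /m /rhombus_mass -mulrA mulr_gt0 ?exprn_gt0 //
    nmulr_rgt0 ?invr_lt0 subr_lt0.
have mE : m * (s ^+ 3 - 8 * a ^+ 3) = a ^+ 3 * (s ^+ 3 - 8) by rewrite divfK.
split => //.
- move=> x; split=> [h|->].
    by apply: (mulIf den); rewrite mE; lra.
  lra.
- split.
    split.
    + by move=> i; elim/forall_ord4: i; rewrite /mass /rhombus_masses.
    (* Two coinciding bodies would be at distance 0, whereas every distance is s, 2 or 2 a. *)
    + move=> i j pij; apply: contraPeq isT => nij.
      move: (rhombus_qdist R a a0 i j nij).
      rewrite /qdist /qvec [X in X - _]pij subrr /enorm trmx0 mul0mx mxE sqrtr0.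
      case: ifP => _; first by move/eqP; rewrite lt_eqF.
      by case: ifP => _ /eqP; rewrite lt_eqF ?mulr_gt0.
    + rewrite sum_ord4; apply/colP => c; elim/forall_ord2: c;
        rewrite /mass /pos /rhombus_masses /rhombus_positions !mxE /=; ring.
  exists (m / (4 * a ^+ 3) + 2 / s ^+ 3).
  apply/(rhombus_central_withE R a m a0 m0).
  split=> //; first by rewrite addr_gt0 // divr_gt0 // ?mulr_gt0 ?exprn_gt0.
  (* Cleared of denominators, the equality of the two expressions of w2 is the equation [mE] that
     defines [m]. *)
  rewrite -/s; apply: (mulIf (_ : 4 * a ^+ 3 * s ^+ 3 != 0)).
    by rewrite gt_eqF ?mulr_gt0 ?exprn_gt0.
  rewrite [LHS](_ : _ = m * s ^+ 3 + 8 * a ^+ 3);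
    last by field; rewrite !gt_eqF.
  rewrite [RHS](_ : _ = a ^+ 3 * s ^+ 3 + 8 * m * a ^+ 3);
    last by field; rewrite !gt_eqF.
  lra.
- move=> w2 cc; split; first exact: rhombus_posdef.
  by apply: nb_neg_eigenvalues_restrict => x; apply: rhombus_form_ge0.
Qed.
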